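(* There exists an absolute constant $c>0$ such that for all integers $m,n$ with $2\le m\le n^{1/3}$, we have $D(m,n)\ge c\sqrt{mn}$.
   Context: For finite sets $\mathcal P,\mathcal Q\subset\mathbb R^2$, $D(\mathcal P,\mathcal Q)=|\{d(p,q): p\in\mathcal P,\ q\in\mathcal Q\}|$ is the number of distinct distances spanned by $\mathcal P\times\mathcal Q$ (distances between two points of the same set are ignored), where $d$ is the Euclidean distance. For $m\le n$, $D(m,n)=\min\{D(\mathcal P,\mathcal Q): \mathcal P,\mathcal Q\subset\mathbb R^2,\ |\mathcal P|=m,\ |\mathcal Q|=n\}$. *)

(* Defs.v *)
From HB Require Import structures.
From mathcomp Require Import all_boot all_order all_algebra.
From mathcomp Require Import finmap.
From mathcomp Require Import boolp reals.

Set Implicit Arguments.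
Unset Strict Implicit.
Unset Printing Implicit Defensive.

Import Order.TTheory GRing.Theory Num.Theory.
Local Open Scope ring_scope.
Local Open Scope fset_scope.

(* The plane is the bare product R * R with an explicit Euclidean distance: the
   norms that MathComp-Analysis puts on R * R and on 'rV[R]_2 are max norms. *)
Definition dist (R : realType) (p q : R * R) : R :=
  Num.sqrt ((p.1 - q.1) ^+ 2 + (p.2 - q.2) ^+ 2).

Definition num_dist (R : realType) (P Q : {fset R * R}) : nat :=
  #|` [fset dist p q | p in P, q in Q] |.

Definition realizable (R : realType) (m n k : nat) : Prop :=
  exists P Q : {fset R * R},
    [/\ #|` P| = m, #|` Q| = n & num_dist P Q = k].

Lemma fset_of_card (R : realType) (n : nat) :
  exists P : {fset R * R}, #|` P| = n.
Proof.
exists [fset ((i%:R : R), (0 : R)) | i in iota 0 n].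
rewrite card_imfset /=; first by rewrite undup_id ?iota_uniq// size_iota.
by move=> i j [] /eqP; rewrite eqr_nat => /eqP.
Qed.

Lemma realizable_nonempty (R : realType) (m n : nat) :
  exists k, `[< realizable R m n k >].
Proof.
have [P Pm] := fset_of_card R m; have [Q Qn] := fset_of_card R n.
by exists (num_dist P Q); apply/asboolP; exists P, Q.
Qed.

Definition min_dist (R : realType) (m n : nat) : nat :=
  ex_minn (realizable_nonempty R m n).

(* Main.v *)
Require Import Defs.
From mathcomp Require Import all_boot all_order all_algebra.
From mathcomp Require Import finmap.
From mathcomp Require Import ring lra zify.
From mathcomp Require Import boolp reals topology normedtype realfun exp.

(** Elekes' argument.  Around each [p] in [P], join every point of [Q] to the
    next point of [Q] on its semicircle, and discard the arcs whose endpoints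
    are strictly separated by a line [p p'] through two points of [P].  If
    [m <= n^(1/3)] and the number [D] of distances is [O(sqrt (m n))], at least
    half of the [m n] candidate arcs survive.  Two surviving arcs sharing an
    endpoint never meet again, since a second meeting point would be the mirror
    image of the first in the line of their centres; in particular there are no
    multiple edges.  The [m D] circles produce [O(m^2 D^2)] crossings, whereas
    the crossing lemma forces at least a constant times
    [(m n)^3 / n^2 = m^3 n] of them, so [D^2] is at least a constant times [m n].
    All arcs are graphs of functions of the abscissa, so that the linear bound
    for plane drawings behind the crossing lemma does not need planar topology. *)

Set Implicit Arguments.
Unset Strict Implicit.
Unset Printing Implicit Defensive.

Import Order.TTheory GRing.Theory Num.Theory.
Import numFieldNormedType.Exports.
Local Open Scope ring_scope.

(** * The crossing lemma, by random vertex colouring *)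

Lemma card_ffun_constrained (V : finType) (k : nat) (U : {set V}) :
  (#|[set f : {ffun V -> 'I_k.+1} | [forall u in U, f u == ord0]]| * k.+1 ^ #|U|
    = k.+1 ^ #|V|)%N.
Proof.
pose F (v : V) : pred 'I_k.+1 := if v \in U then pred1 ord0 else predT.
have -> : #|[set f : {ffun V -> 'I_k.+1} | [forall u in U, f u == ord0]]|
    = #|family F|.
  rewrite cardsE; apply: eq_card => f; rewrite !inE.
  apply/forall_inP/familyP => [fU v|fF u uU].
    by rewrite /F; case: ifP => // /fU.
  by have := fF u; rewrite /F uU.
rewrite card_family foldrE big_map big_enum /=.
rewrite -(cardsC U) expnD mulnC; congr (_ * _)%N.
have -> : (\prod_(v : V) #|F v| = \prod_(v : V) if v \in ~: U then k.+1 else 1)%N.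
  apply: eq_bigr => v _; rewrite /F inE; case: ifP => _ /=; first exact: card1.
  exact: card_ord.
by rewrite -big_mkcond prod_nat_const.
Qed.

Section CrossingLemma.
Variables (V E : finType) (l r : E -> V) (cr : rel E) (G : {set E}).
Hypothesis loopless : forall e, e \in G -> l e != r e.
Hypothesis crossing_disjoint : forall e f, e \in G -> f \in G -> cr e f ->
  uniq [:: l e; r e; l f; r f].
Hypothesis linear_bound : forall (S : {set V}) (F : {set E}),
  F \subset G -> {in F, forall e, (l e \in S) && (r e \in S)} ->
  {in F &, forall e f, ~~ cr e f} -> (#|F| <= 3 * #|S|)%N.

Let X := [set ef : E * E | [&& ef.1 \in G, ef.2 \in G & cr ef.1 ef.2]].

Let inS (S : {set V}) e := (l e \in S) && (r e \in S).

(** Dropping the first edge of every crossing inside [S] leaves a crossing-free set of edges, to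
    which [linear_bound] applies. *)
Lemma deletion_bound (S : {set V}) :
  (#|[set e in G | inS S e]|
    <= 3 * #|S| + #|[set ef in X | inS S ef.1 && inS S ef.2]|)%N.
Proof.
set GS := [set e in G | _]; set XS := [set ef in X | _].
pose B := [set ef.1 | ef in XS].
have BG : B \subset GS.
  apply/subsetP => e /imsetP [[e' f']]; rewrite !inE /=.
  by case/andP => /and3P [e'G _ _] /andP [e'S _] ->; rewrite e'G.
have -> : #|GS| = (#|GS :\: B| + #|B|)%N.
  by rewrite addnC -(cardsID B GS); congr (_ + _)%N; rewrite (setIidPr BG).
apply: leq_add; last exact: leq_imset_card.
apply: linear_bound.
- by apply/subsetP => e; rewrite !inE => /and3P [].
- by move=> e; rewrite !inE => /and3P [].
move=> e f; rewrite inE => /andP [eB eG]; rewrite inE => /andP [_ fG].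
apply/negP => ef; move/negP: eB; apply; apply/imsetP; exists (e, f) => //.
by move: eG fG; rewrite !inE /= ef => /andP [-> ->] /andP [-> ->].
Qed.

(* Colour the vertices uniformly with [k] colours and apply [deletion_bound] to
   one colour class: a vertex, an edge, a crossing survive with probability
   [k^-1], [k^-2], [k^-4]. *)
Lemma crossing_lemma (k : nat) : (0 < k)%N ->
  (#|G| * k ^ 2 <= 3 * #|V| * k ^ 3 + #|X|)%N.
Proof.
case: k => // k _.
pose T := {ffun V -> 'I_k.+1}.
pose S (f : T) := [set v | f v == ord0].
pose N (U : {set V}) := #|[set f : T | [forall u in U, f u == ord0]]|.
have count (A : finType) (W : {set A}) (U : A -> {set V}) :
    (\sum_(f : T) #|[set a in W | U a \subset S f]| = \sum_(a in W) N (U a))%N.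
  transitivity (\sum_(f : T) \sum_(a in W) (U a \subset S f : nat))%N.
    apply: eq_bigr => f _; rewrite -sum1dep_card big_mkcondr.
    by apply: eq_bigr => a _; case: ifP.
  rewrite exchange_big; apply: eq_bigr => a _ /=.
  rewrite -big_mkcond /= sum1dep_card; apply: eq_card => f; rewrite !inE.
  apply/subsetP/forall_inP => h u /h; by rewrite inE.
have := leq_sum (index_enum T) (fun f (_ : true) => deletion_bound (S f)).
rewrite big_split -big_distrr /=.
have -> : (\sum_(f : T) #|[set e in G | inS (S f) e]|
    = \sum_(e in G) N [set l e; r e])%N.
  rewrite -count; apply: eq_bigr => f _; apply: eq_card => e.
  by rewrite !inE /inS subUset !sub1set.
have -> : (\sum_(f : T) #|S f| = \sum_(v in [set: V]) N [set v])%N.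
  rewrite -count; apply: eq_bigr => f _; apply: eq_card => v.
  by rewrite !inE /inS !sub1set inE.
have -> : (\sum_(f : T) #|[set ef in X | inS (S f) ef.1 && inS (S f) ef.2]|
    = \sum_(ef in X) N ([set l ef.1; r ef.1] :|: [set l ef.2; r ef.2]))%N.
  rewrite -count; apply: eq_bigr => f _; apply: eq_card => e.
  by rewrite !inE /inS !subUset !sub1set !inE.
have NE U : (N U * k.+1 ^ #|U| = k.+1 ^ #|V|)%N by exact: card_ffun_constrained.
(* With this factor, [NE] turns each [N U], where [U] has 1, 2 or 4 elements, into the number of all
   colourings times a power of [k.+1]. *)
rewrite -(leq_pmul2r (m := k.+1 ^ 4)); last by rewrite expn_gt0.
rewrite mulnDl -(mulnA 3) !big_distrl /=.
rewrite (eq_bigr (fun=> (k.+1 ^ #|V| * k.+1 ^ 2)%N)); last first.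
  move=> e eG; rewrite -(NE [set l e; r e]) cards2 (loopless eG) -mulnA.
  by rewrite -expnD.
rewrite [X in (_ <= 3 * X + _)%N](eq_bigr (fun=> (k.+1 ^ #|V| * k.+1 ^ 3)%N)); last first.
  by move=> v _; rewrite -(NE [set v]) cards1 -mulnA -expnD.
rewrite [X in (_ <= _ + X)%N](eq_bigr (fun=> (k.+1 ^ #|V|)%N)); last first.
  move=> [e f]; rewrite inE /= => /and3P [eG fG ef].
  set U := (_ :|: _); rewrite -(NE U); congr (_ * _)%N; congr (_ ^ _)%N.
  have -> : U = [set x in [:: l e; r e; l f; r f]].
    by apply/setP => x; rewrite !inE /= !orbA.
  by rewrite cardsE (card_uniqP (crossing_disjoint eG fG ef)).
rewrite !sum_nat_const cardsT.
have -> : (3 * (#|V| * (k.+1 ^ #|V| * k.+1 ^ 3)) + #|X| * k.+1 ^ #|V|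
  = (3 * #|V| * k.+1 ^ 3 + #|X|) * k.+1 ^ #|V|)%N.
  by rewrite mulnDl; congr addn; rewrite [(k.+1 ^ #|V| * _)%N]mulnC !mulnA.
by rewrite mulnCA mulnC leq_pmul2r ?expn_gt0.
Qed.

End CrossingLemma.

(** * Linear bound for non-crossing arcs that are graphs of functions *)

Section NoncrossingArcs.
Variables (R : realDomainType) (V E : finType) (vx vy : V -> R).
Variables (l r : E -> V) (g : E -> R -> R) (S : {set V}) (F : {set E}).
Local Notation lx e := (vx (l e)).
Local Notation rx e := (vx (r e)).
Hypothesis position_inj : forall z z', vx z = vx z' -> vy z = vy z' -> z = z'.
Hypothesis endsS : forall e, e \in F -> (l e \in S) && (r e \in S).
Hypothesis lx_lt_rx : forall e, e \in F -> lx e < rx e.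
Hypothesis arc_left : forall e, e \in F -> g e (lx e) = vy (l e).
Hypothesis arc_right : forall e, e \in F -> g e (rx e) = vy (r e).
Hypothesis arc_avoids : forall e z, e \in F -> z \in S ->
  lx e < vx z < rx e -> g e (vx z) <> vy z.
Hypothesis arcs_ordered : forall e f x y, e \in F -> f \in F ->
  lx e <= x <= rx e -> lx f <= x <= rx f ->
  lx e <= y <= rx e -> lx f <= y <= rx f ->
  g e x < g f x -> g e y <= g f y.
Hypothesis arcs_disjoint : forall e f x, e \in F -> f \in F -> e <> f ->
  lx e < x < rx e -> lx f < x < rx f -> g e x <> g f x.
Hypothesis simple : forall e f, e \in F -> f \in F ->
  l e = l f -> r e = r f -> e = f.

Lemma vertex_on_arc e z : e \in F -> z \in S -> lx e <= vx z <= rx e ->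
  g e (vx z) = vy z -> z = l e \/ z = r e.
Proof.
move=> eF zS /andP [lz zr] gz.
have [lz'|lz'|Elz] := ltgtP (lx e) (vx z); last 2 first.
- by move: lz; rewrite leNgt lz'.
- by left; apply: position_inj => //; rewrite -gz -Elz arc_left.
have [zr'|zr'|Ezr] := ltgtP (vx z) (rx e).
- by case: (@arc_avoids e z) => //; rewrite lz'.
- by move: zr; rewrite leNgt zr'.
- by right; apply: position_inj => //; rewrite -gz Ezr arc_right.
Qed.

(** The interiors are disjoint, so a meeting point is an endpoint of one of the arcs, and the other
    arc meets no vertex except its own endpoints. *)
Lemma touch_at_vertex e f x : e \in F -> f \in F -> e <> f ->
  lx e <= x <= rx e -> lx f <= x <= rx f -> g e x = g f x ->
  exists z, [/\ vx z = x, z = l e \/ z = r e & z = l f \/ z = r f].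
Proof.
move=> eF fF ef xe xf gx.
have [leS reS] := andP (endsS eF); have [lfS rfS] := andP (endsS fF).
have [Ex|xl] := eqVneq x (lx e).
  exists (l e); split; [by []|by left|apply: vertex_on_arc => //].
    by rewrite -Ex.
  by rewrite -Ex -gx Ex arc_left.
have [Ex|xr] := eqVneq x (rx e).
  exists (r e); split; [by []|by right|apply: vertex_on_arc => //].
    by rewrite -Ex.
  by rewrite -Ex -gx Ex arc_right.
have [Ex|xl'] := eqVneq x (lx f).
  exists (l f); split; [by []|apply: vertex_on_arc => //|by left].
    by rewrite -Ex.
  by rewrite -Ex gx Ex arc_left.
have [Ex|xr'] := eqVneq x (rx f).
  exists (r f); split; [by []|apply: vertex_on_arc => //|by right].
    by rewrite -Ex.
  by rewrite -Ex gx Ex arc_right.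
case: (@arcs_disjoint e f x) => //.
- by rewrite !lt_neqAle (eq_sym (lx e)) xl xr.
- by rewrite !lt_neqAle (eq_sym (lx f)) xl' xr'.
Qed.

Lemma fork_right e f x : e \in F -> f \in F -> e <> f -> l e = l f ->
  lx e < x -> x <= rx e -> x <= rx f -> g e x <> g f x.
Proof.
move=> eF fF ef lef ltx xe xf gx.
have [||z [zx ze zf]] := touch_at_vertex eF fF ef _ _ gx.
- by rewrite ltW.
- by rewrite -lef ltW.
apply: ef; apply: simple => //; case: ze => ze; first by rewrite -zx ze ltxx in ltx.
case: zf => zf; first by rewrite -zx zf lef ltxx in ltx.
by rewrite -ze -zf.
Qed.

Lemma fork_left e f x : e \in F -> f \in F -> e <> f -> r e = r f ->
  x < rx e -> lx e <= x -> lx f <= x -> g e x <> g f x.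
Proof.
move=> eF fF ef ref ltx xe xf gx.
have [||z [zx ze zf]] := touch_at_vertex eF fF ef _ _ gx.
- by rewrite xe ltW.
- by rewrite xf -ref ltW.
apply: ef; apply: simple => //; case: ze => ze; last by rewrite -zx ze ltxx in ltx.
case: zf => zf; last by rewrite -zx zf ref ltxx in ltx.
by rewrite -ze -zf.
Qed.

(** A charging scheme: an arc is charged to its left endpoint if it is the top arc leaving it, to
    its right endpoint if it is the top arc entering it, and otherwise to a vertex above it that it
    sees with no arc in between. A vertex gets at most one charge of each kind, whence the factor 3.
    Arcs with a common endpoint are compared at the far end of their common range. *)
Let above_right e := [pred f | [&& f \in F, l f == l e &
  g e (Num.min (rx e) (rx f)) < g f (Num.min (rx e) (rx f))]].
Let above_left e := [pred f | [&& f \in F, r f == r e &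
  g e (Num.max (lx e) (lx f)) < g f (Num.max (lx e) (lx f))]].
Let sees e := [pred z | [&& z \in S, lx e < vx z < rx e, g e (vx z) < vy z &
  [forall f in F, (lx f < vx z < rx f) ==> ~~ (g e (vx z) < g f (vx z) < vy z)]]].

Lemma right_top_le : (#|[set e in F | ~~ [exists f, above_right e f]]| <= #|S|)%N.
Proof.
rewrite -(@card_in_imset _ _ l); last first.
  move=> e f; rewrite !inE => /andP [eF te] /andP [fF tf] lef.
  apply/eqP/negPn/negP => /eqP ef.
  pose x := Num.min (rx e) (rx f).
  have xe : lx e < x by rewrite lt_min lx_lt_rx //= lef lx_lt_rx.
  have [lt|lt|/fork_right] := ltgtP (g e x) (g f x).
  - by move/negP: te; apply; apply/existsP; exists f; rewrite /= fF lef eqxx.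
  - move/negP: tf; apply; apply/existsP; exists e.
    by rewrite /= eF lef eqxx /= minC.
  - by apply => //; rewrite ge_min lexx ?orbT.
apply: subset_leq_card; apply/subsetP => z /imsetP [e].
by rewrite !inE => /andP [/endsS /andP [? _] _] ->.
Qed.

Lemma left_top_le : (#|[set e in F | ~~ [exists f, above_left e f]]| <= #|S|)%N.
Proof.
rewrite -(@card_in_imset _ _ r); last first.
  move=> e f; rewrite !inE => /andP [eF te] /andP [fF tf] ref.
  apply/eqP/negPn/negP => /eqP ef.
  pose x := Num.max (lx e) (lx f).
  have xe : x < rx e by rewrite gt_max lx_lt_rx //= ref lx_lt_rx.
  have [lt|lt|/fork_left] := ltgtP (g e x) (g f x).
  - by move/negP: te; apply; apply/existsP; exists f; rewrite /= fF ref eqxx.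
  - move/negP: tf; apply; apply/existsP; exists e.
    by rewrite /= eF ref eqxx /= maxC.
  - by apply => //; rewrite le_max lexx ?orbT.
apply: subset_leq_card; apply/subsetP => z /imsetP [e].
by rewrite !inE => /andP [/endsS /andP [_ ?] _] ->.
Qed.

(** The arcs leaving [l e] keep the same vertical order all along, so the lowest of those above [e]
    at one common abscissa is the next one above [e] everywhere. *)
Lemma next_above_right e f : e \in F -> above_right e f ->
  exists h, [/\ h \in F, l h = l e,
    forall x, lx e < x -> x <= rx e -> x <= rx h -> g e x < g h x &
    forall k x, k \in F -> l k = l e -> lx e < x -> x <= rx e -> x <= rx h ->
      x <= rx k -> g e x < g k x -> g h x <= g k x].
Proof.
move=> eF /and3P [fF /eqP lfe ef].
(* [x0] is so close to [l e] that all arcs leaving [l e] to the right reach it. *)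
pose h0 := [arg min_(h < e | (h \in F) && (l h == l e)) rx h]%O.
have [h0F lh0 h0min] : [/\ h0 \in F, l h0 = l e &
    forall h, h \in F -> l h = l e -> rx h0 <= rx h].
  rewrite /h0; case: arg_minP; first by rewrite eF eqxx.
  move=> i /andP [iF /eqP li] imin; split => // h hF lh.
  by apply: imin; rewrite hF lh eqxx.
pose x0 := rx h0.
have x0gt : lx e < x0 by rewrite -lh0 lx_lt_rx.
have transfer a b x y : a \in F -> b \in F -> l a = l e -> l b = l e ->
    lx e < x -> x <= rx a -> x <= rx b -> lx e < y -> y <= rx a -> y <= rx b ->
    g a x < g b x -> g a y < g b y.
  move=> aF bF la lb ex xa xb ey ya yb lt.
  have nab : a <> b by move=> ab; rewrite ab ltxx in lt.
  rewrite lt_neqAle; apply/andP; split.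
    by apply/eqP; apply: fork_right => //; rewrite ?la ?lb.
  by apply: (@arcs_ordered a b x y) => //; rewrite ?la ?lb ?xa ?xb ?ya ?yb andbT ltW.
have ef0 : g e x0 < g f x0.
  apply: (transfer e f (Num.min (rx e) (rx f))) => //.
  - by rewrite lt_min lx_lt_rx // -lfe lx_lt_rx.
  - by rewrite ge_min lexx.
  - by rewrite ge_min lexx orbT.
  - exact: h0min.
  - exact: h0min.
pose C := [pred h | [&& h \in F, l h == l e & g e x0 < g h x0]].
pose h := [arg min_(h < f | C h) g h x0]%O.
have [hF lh eh hmin] : [/\ h \in F, l h = l e, g e x0 < g h x0 &
    forall k, k \in F -> l k = l e -> g e x0 < g k x0 -> g h x0 <= g k x0].
  rewrite /h; case: arg_minP; first by rewrite /= fF lfe eqxx ef0.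
  move=> i /and3P [iF /eqP li ei] imin; split => // k kF lk ek.
  by apply: imin; rewrite /= kF lk eqxx ek.
exists h; split => //.
  by move=> x ex xe xh; apply: (transfer e h x0 x) => //; exact: h0min.
move=> k x kF lk ex xe xh xk ek.
rewrite leNgt; apply/negP => kh.
have : g k x0 < g h x0 by apply: (transfer k h x x0) => //; exact: h0min.
by rewrite ltNge hmin //; apply: (transfer e k x x0) => //; exact: h0min.
Qed.

(** The vertex is a leftmost one in the wedge between [e] and the next arc [h] above it at [l e];
    [Z] describes the vertices of that wedge. *)
Lemma exists_sees e f f' : e \in F -> above_right e f -> above_left e f' ->
  exists z, sees e z.
Proof.
move=> eF /(next_above_right eF) [h [hF lh eh hnext]] /and3P [f'F /eqP rf' ef'].
have [leS reS] := andP (endsS eF).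
have [lhS rhS] := andP (endsS hF).
have [lf'S rf'S] := andP (endsS f'F).
have leh : lx h <= rx h by rewrite ltW ?lx_lt_rx.
pose Z := [pred z | [&& z \in S, lx e < vx z < rx e, vx z <= rx h,
   g e (vx z) < vy z & vy z <= g h (vx z)]].
(* If [h] ends before [e], its end [r h] lies in the wedge. Otherwise [h] passes above [r e], where
   [f'] ends; then [f'] stays below [h], hence cannot reach back to the abscissa of [l e], and
   [l f'] lies in the wedge. *)
have [z0 z0Z] : exists z, Z z.
  have [hr|hr] := ltP (rx h) (rx e).
    exists (r h); rewrite /= rhS -{1}lh lx_lt_rx // hr lexx arc_right // lexx.
    by rewrite -(arc_right hF) eh // -?lh ?lx_lt_rx // ltW.
  have nfe : f' <> e by move=> eq; rewrite eq ltxx in ef'.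
  have lre := lx_lt_rx eF.
  have eh_r : vy (r e) < g h (rx e) by rewrite -arc_right // eh.
  have f'e : g f' (rx e) = vy (r e) by rewrite -rf' arc_right.
  have m_lt : Num.max (lx e) (lx f') < rx e.
    by rewrite gt_max lre -rf' lx_lt_rx.
  have ef'_le x : lx e <= x -> lx f' <= x -> x <= rx e -> g e x <= g f' x.
    move=> ex f'x xe.
    apply: (arcs_ordered eF f'F _ _ _ _ ef'); rewrite ?rf' ?ex ?f'x //=.
    - by rewrite le_max lexx (ltW m_lt).
    - by rewrite le_max lexx orbT (ltW m_lt).
  have ef'_lt x : lx e <= x -> lx f' <= x -> x < rx e -> g e x < g f' x.
    move=> ex f'x xe; rewrite lt_neqAle (ef'_le _ ex f'x (ltW xe)) andbT.
    by apply/eqP; apply: fork_left => //; exact: nesym.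
  have lf' : lx e < lx f'.
    rewrite ltNge; apply/negP => le1.
    have : g h (lx e) < g f' (lx e).
      by rewrite -{1}lh arc_left // lh -arc_left // ef'_lt.
    move/(arcs_ordered hF f'F) => /(_ (rx e)).
    rewrite lh lexx -rf' le1 (ltW (lx_lt_rx f'F)) lexx rf' (ltW lre) hr.
    rewrite (le_trans (ltW lre) hr) /= => /(_ isT isT isT isT).
    by rewrite f'e leNgt eh_r.
  have f're : lx f' < rx e by rewrite -rf' lx_lt_rx.
  exists (l f'); rewrite /= lf'S lf' f're -(arc_left f'F) ef'_lt //; last exact: ltW.
  rewrite (le_trans (ltW f're) hr) /=.
  have : g f' (rx e) < g h (rx e) by rewrite f'e.
  move/(arcs_ordered f'F hF); apply; rewrite ?rf' ?lh ?lexx ?hr ?(ltW lre) //.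
  - by rewrite ltW.
  - by rewrite ltW.
  - by rewrite ltW //= (le_trans (ltW f're)).
pose z1 := [arg min_(z < z0 | Z z) vx z]%O.
have [z1Z z1min] : Z z1 /\ forall z, Z z -> vx z1 <= vx z.
  by rewrite /z1; case: arg_minP.
pose z := [arg min_(z < z1 | Z z && (vx z == vx z1)) vy z]%O.
have [zZ zx zmin] : [/\ Z z, vx z = vx z1 &
    forall y, Z y -> vx y = vx z -> vy z <= vy y].
  rewrite /z; case: arg_minP; first by rewrite z1Z eqxx.
  move=> i /andP [iZ /eqP ix] imin; split => // y yZ yx.
  by apply: imin; rewrite yZ yx ix eqxx.
exists z; have /and5P [zS zlr zh ez zh'] := zZ.
have [lz zr] := andP zlr.
rewrite /= zS zlr ez /=; apply/forall_inP => k kF; apply/implyP => /andP [kl kr].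
apply/negP => /andP [ek kz].
have [lkS rkS] := andP (endsS kF).
have kh : g k (vx z) < g h (vx z) by exact: lt_le_trans kz zh'.
have zIe : lx e <= vx z <= rx e by rewrite !ltW.
have zIk : lx k <= vx z <= rx k by rewrite !ltW.
have zIh : lx h <= vx z <= rx h by rewrite lh ltW.
have ek_ne : e <> k by move=> eq; rewrite eq ltxx in ek.
have kh_ne : k <> h by move=> eq; rewrite eq ltxx in kh.
(* An arc [k] between [e] and [z] that starts inside the wedge puts [l k] in [Z], further left than
   [z]. *)
have [lk|lk] := ltP (lx e) (lx k).
  suff kZ : Z (l k) by move: (z1min _ kZ); rewrite -zx leNgt kl.
  have Ike : lx e <= lx k <= rx e by rewrite !ltW // (lt_trans kl).
  have Ikk : lx k <= lx k <= rx k by rewrite lexx ltW ?lx_lt_rx.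
  have Ikh : lx h <= lx k <= rx h by rewrite lh ltW //= (le_trans (ltW kl)).
  have ek' := arcs_ordered eF kF zIe zIk Ike Ikk ek.
  have kh'' := arcs_ordered kF hF zIk zIh Ikk Ikh kh.
  rewrite /= lkS lk (lt_trans kl zr) (le_trans (ltW kl) zh) -(arc_left kF) kh''.
  rewrite andbT lt_neqAle ek' !andbT; apply/eqP; rewrite arc_left //.
  by apply: arc_avoids => //; rewrite lk (lt_trans kl zr).
(* Otherwise [k] is squeezed between [e] and [h] at [l e], so it starts there and contradicts the
   choice of [h]. *)
have lre : lx e <= rx e by rewrite ltW ?lx_lt_rx.
have Ile : lx e <= lx e <= rx e by rewrite lexx.
have Ilk : lx k <= lx e <= rx k by rewrite lk (le_trans (ltW lz) (ltW kr)).
have Ilh : lx h <= lx e <= rx h by rewrite lh lexx -lh.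
have klE : g k (lx e) = vy (l e).
  apply/le_anti; rewrite -{2}arc_left //.
  rewrite (arcs_ordered eF kF zIe zIk Ile Ilk ek) andbT.
  rewrite (_ : vy (l e) = g h (lx e)); last by rewrite -lh arc_left.
  exact: (arcs_ordered kF hF zIk zIh Ilk Ilh kh).
have lkE : l k = l e.
  have [//|eq] := vertex_on_arc kF leS Ilk klE.
  by move: (lt_trans lz kr); rewrite eq ltxx.
have := hnext k (vx z) kF lkE lz (ltW zr) zh (ltW kr) ek.
by rewrite leNgt kh.
Qed.

(** Of two distinct arcs below [z], the higher one hides [z] from the lower one. *)
Lemma sees_inj e f z : e \in F -> f \in F -> sees e z -> sees f z -> e = f.
Proof.
move=> eF fF /and4P [_ ze ez /forall_inP /(_ f fF)] e_first.
move=> /and4P [_ zf fz /forall_inP /(_ e eF)] f_first.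
rewrite zf fz andbT in e_first; rewrite ze ez andbT in f_first.
apply/eqP/negPn/negP => /eqP ef.
have := arcs_disjoint eF fF ef ze zf.
by case: ltgtP e_first f_first.
Qed.

Lemma noncrossing_arcs_bound : (#|F| <= 3 * #|S|)%N.
Proof.
set A := [set e in F | ~~ [exists f, above_right e f]].
set B := [set e in F | ~~ [exists f, above_left e f]].
have sub : (#|F :\: (A :|: B)| <= #|S|)%N.
  pose t e := odflt (l e) [pick z | sees e z].
  have tP e : e \in F :\: (A :|: B) -> e \in F /\ sees e (t e).
    rewrite !inE negb_or => /andP [/andP [+ +] eF]; rewrite eF !negbK.
    move=> /existsP [f ef] /existsP [f' ef']; split => //.
    rewrite /t; case: pickP => [z //|no].
    by have [z] := exists_sees eF ef ef'; rewrite no.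
  rewrite -(@card_in_imset _ _ t); last first.
    move=> e f /tP [eF et] /tP [fF ft] Et.
    by apply: (sees_inj eF fF et); rewrite Et.
  apply: subset_leq_card; apply/subsetP => z /imsetP [e /tP [_ +] ->].
  by case/and4P.
rewrite -(cardsID (A :|: B) F) mulSn addnC leq_add //.
apply: leq_trans (subset_leq_card (subsetIr _ _)) _.
apply: leq_trans (leq_card_setU _ _) _.
by rewrite mul2n -addnn leq_add ?right_top_le ?left_top_le.
Qed.

End NoncrossingArcs.

(** * Circles, lines through their centres, and semicircles *)

Section PlaneGeometry.
Variable R : realType.
Implicit Types (p w u : R * R).

Definition sqdist p w : R := (p.1 - w.1) ^+ 2 + (p.2 - w.2) ^+ 2.

(** Twice the signed area of the triangle [p p' w]: its sign tells the side of the line [p p'] on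
    which [w] lies. *)
Definition side p p' w : R :=
  (p'.1 - p.1) * (w.2 - p.2) - (p'.2 - p.2) * (w.1 - p.1).

(** The two distances fix the component of the point along the line of centres; Lagrange's identity
    then fixes the square of the transverse one. *)
Lemma two_circles_side p p' w u :
  sqdist p w = sqdist p u -> sqdist p' w = sqdist p' u ->
  side p p' w ^+ 2 = side p p' u ^+ 2.
Proof.
rewrite /sqdist /side; move: p p' w u => [a b] [c d] [x y] [z t] /= h1 h2.
have dots : (c - a) * (x - a) + (d - b) * (y - b)
    = (c - a) * (z - a) + (d - b) * (t - b) by lra.
have lagrange x' y' : ((c - a) * (y' - b) - (d - b) * (x' - a)) ^+ 2
    = ((c - a) ^+ 2 + (d - b) ^+ 2) * ((a - x') ^+ 2 + (b - y') ^+ 2)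
      - ((c - a) * (x' - a) + (d - b) * (y' - b)) ^+ 2 by ring.
by rewrite !lagrange h1 dots.
Qed.

(** The vector from [u] to [w] has zero dot product and zero cross product with the nonzero vector
    from [p] to [p']. *)
Lemma two_circles_inj p p' w u : p <> p' ->
  sqdist p w = sqdist p u -> sqdist p' w = sqdist p' u ->
  side p p' w = side p p' u -> w = u.
Proof.
rewrite /sqdist /side; move: p p' w u => [a b] [c d] [x y] [z t] /= pp' h1 h2 h3.
have dots : (c - a) * (x - z) + (d - b) * (y - t) = 0 by lra.
have crosses : (c - a) * (y - t) - (d - b) * (x - z) = 0 by lra.
have N0 : (c - a) ^+ 2 + (d - b) ^+ 2 != 0.
  rewrite paddr_eq0 ?sqr_ge0 // !sqrf_eq0 !subr_eq0.
  by apply/negP => /andP [/eqP ca /eqP db]; apply: pp'; rewrite ca db.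
have Ex : ((c - a) ^+ 2 + (d - b) ^+ 2) * (x - z) = 0.
  transitivity ((c - a) * ((c - a) * (x - z) + (d - b) * (y - t))
    - (d - b) * ((c - a) * (y - t) - (d - b) * (x - z))); first by ring.
  by rewrite dots crosses !mulr0 subr0.
have Ey : ((c - a) ^+ 2 + (d - b) ^+ 2) * (y - t) = 0.
  transitivity ((d - b) * ((c - a) * (x - z) + (d - b) * (y - t))
    + (c - a) * ((c - a) * (y - t) - (d - b) * (x - z))); first by ring.
  by rewrite dots crosses !mulr0 addr0.
move/eqP: Ex; move/eqP: Ey; rewrite !mulf_eq0 (negPf N0) /= !subr_eq0.
by move=> /eqP -> /eqP ->.
Qed.

Lemma semicircle_det_gt0 (x y x' y' : R) : x < x' -> 0 <= y -> 0 <= y' ->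
  0 < y + y' -> x ^+ 2 + y ^+ 2 = x' ^+ 2 + y' ^+ 2 -> 0 < x' * y - x * y'.
Proof.
move=> xx' y0 y'0 yy' h.
suff : 0 < (y + y') * (2 * (x' * y - x * y')) by rewrite !pmulr_rgt0.
have -> : (y + y') * (2 * (x' * y - x * y')) =
    (x' - x) * ((y + y') ^+ 2 + (x + x') ^+ 2)
    + (x' + x) * (x ^+ 2 + y ^+ 2 - (x' ^+ 2 + y' ^+ 2)) by ring.
rewrite h subrr mulr0 addr0 mulr_gt0 ?subr_gt0 //.
by rewrite ltr_pwDl ?sqr_ge0 // exprn_gt0.
Qed.

Lemma sqr_lt_between (x t y d : R) : x < t -> t < y -> x ^+ 2 <= d ->
  y ^+ 2 <= d -> t ^+ 2 < d.
Proof.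
move=> xt ty xd yd; have [t0|t0] := leP 0 t.
  by apply: lt_le_trans yd; rewrite ltr_pXn2r // nnegrE ltW // (le_lt_trans t0).
apply: lt_le_trans xd; rewrite -sqrrN -(sqrrN x).
by rewrite ltr_pXn2r ?ltrN2 // nnegrE oppr_ge0 ltW // (lt_trans xt).
Qed.

(* The middle point is a positive combination of the outer two, unless those
   are antipodal, in which case the linear form has opposite values at them. *)
Lemma semicircle_linear_gt0 (a b x1 y1 x2 y2 x3 y3 : R) :
  x1 < x2 -> x2 < x3 -> 0 <= y1 -> 0 <= y2 -> 0 <= y3 ->
  x1 ^+ 2 + y1 ^+ 2 = x2 ^+ 2 + y2 ^+ 2 -> x3 ^+ 2 + y3 ^+ 2 = x2 ^+ 2 + y2 ^+ 2 ->
  0 <= a * x1 + b * y1 -> 0 <= a * x3 + b * y3 ->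
  0 < (a * x1 + b * y1) + (a * x3 + b * y3) -> 0 < a * x2 + b * y2.
Proof.
move=> x12 x23 y1_0 y2_0 y3_0 h1 h3 s1 s3 s13.
have y2_gt0 : 0 < y2.
  have : x2 ^+ 2 < x2 ^+ 2 + y2 ^+ 2.
    by apply: (sqr_lt_between x12 x23); [rewrite -h1|rewrite -h3]; rewrite lerDl sqr_ge0.
  by rewrite ltrDl lt_neqAle eq_sym sqrf_eq0 => /andP [y2n0 _]; rewrite lt_neqAle eq_sym y2n0.
have d12 : 0 < x2 * y1 - x1 * y2 by apply: semicircle_det_gt0; rewrite ?ltr_wpDl.
have d23 : 0 < x3 * y2 - x2 * y3 by apply: semicircle_det_gt0; rewrite ?ltr_pwDl.
have d13 : 0 <= x3 * y1 - x1 * y3.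
  have [y13|] := ltP 0 (y1 + y3).
    by apply/ltW/semicircle_det_gt0; rewrite ?h1 ?h3 // (lt_trans x12).
  move=> y13; have [-> ->] : y1 = 0 /\ y3 = 0 by split; lra.
  by rewrite !mulr0 subr0.
have cramer : (a * x2 + b * y2) * (x3 * y1 - x1 * y3) =
   (a * x1 + b * y1) * (x3 * y2 - x2 * y3) + (a * x3 + b * y3) * (x2 * y1 - x1 * y2).
  by ring.
rewrite ltNge; apply/negP => s2.
have : (a * x2 + b * y2) * (x3 * y1 - x1 * y3) <= 0 by rewrite mulr_le0_ge0.
rewrite cramer leNgt => /negP; apply.
have [s1_0|s1_0] := ltP 0 (a * x1 + b * y1).
  by rewrite ltr_pwDl ?mulr_gt0 // mulr_ge0 // ltW.
by rewrite ltr_wpDl ?mulr_ge0 ?(ltW d23) // mulr_gt0 //; lra.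
Qed.

(** Points level with the centre count as upper, so each circle is split into two disjoint
    halves. *)
Definition same_half p u w := (p.2 <= u.2) == (p.2 <= w.2).

(** The line passes through the centre [p], so [side] is a homogeneous linear form in coordinates
    centred at [p]. Reflecting a lower semicircle by [sg] and changing the sign of the form if
    needed reduces to [semicircle_linear_gt0]. The sum of the two outer values carries their common
    sign. *)
Lemma side_between p p' u v w : u.1 < w.1 -> w.1 < v.1 ->
  sqdist p u = sqdist p w -> sqdist p v = sqdist p w ->
  same_half p u w -> same_half p v w ->
  0 <= side p p' u * side p p' v -> side p p' u + side p p' v != 0 ->
  0 < (side p p' u + side p p' v) * side p p' w.
Proof.
move=> uw wv hu hv /eqP hlu /eqP hlv suv nz.
pose sg : R := if p.2 <= w.2 then 1 else -1.
have sg2 : sg * sg = 1 by rewrite /sg; case: ifP => _; rewrite ?mulrNN mulr1.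
pose Y (z : R * R) := sg * (z.2 - p.2); pose X (z : R * R) := z.1 - p.1.
have sY z : z.2 - p.2 = sg * Y z by rewrite /Y mulrA sg2 mul1r.
have Y0 z : (p.2 <= z.2) = (p.2 <= w.2) -> 0 <= Y z.
  rewrite /Y /sg => <-; case: (leP p.2 z.2) => h; first by rewrite mul1r subr_ge0.
  by rewrite mulN1r opprB subr_ge0 ltW.
have sq z : X z ^+ 2 + Y z ^+ 2 = sqdist p z.
  transitivity (X z ^+ 2 + (sg * sg) * Y z ^+ 2); first by rewrite sg2 mul1r.
  by rewrite -(expr2 sg) -exprMn -sY /sqdist /X; ring.
have [al [be sE]] : exists al be, forall z, side p p' z = al * X z + be * Y z.
  exists (- (p'.2 - p.2)), ((p'.1 - p.1) * sg) => z.
  by rewrite /side sY /X; ring.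
have core a b : 0 <= a * X u + b * Y u -> 0 <= a * X v + b * Y v ->
    0 < (a * X u + b * Y u) + (a * X v + b * Y v) -> 0 < a * X w + b * Y w.
  apply: semicircle_linear_gt0; rewrite ?sq ?ltrD2r ?Y0 //.
have pos : 0 <= side p p' u -> 0 <= side p p' v ->
    0 < side p p' u + side p p' v -> 0 < side p p' w.
  by rewrite !sE; exact: core.
have neg : side p p' u <= 0 -> side p p' v <= 0 ->
    side p p' u + side p p' v < 0 -> side p p' w < 0.
  move=> su sv suv'; rewrite sE -oppr_gt0 opprD -!mulNr.
  by apply: core; rewrite !mulNr -!opprD -!sE ?oppr_ge0 ?oppr_gt0.
have both_neg : side p p' u <= 0 -> side p p' v <= 0 ->
    0 < (side p p' u + side p p' v) * side p p' w.
  move=> su sv; have lt0 : side p p' u + side p p' v < 0.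
    by rewrite lt_neqAle nz -(addr0 0) lerD.
  by rewrite nmulr_rgt0 // neg.
have [su|su] := leP 0 (side p p' u); last first.
  by apply: both_neg; [exact: ltW | rewrite nmulr_rge0 in suv].
have [sv|sv] := leP 0 (side p p' v); last first.
  by apply: both_neg; [rewrite nmulr_lge0 in suv | exact: ltW].
have gt0 : 0 < side p p' u + side p p' v.
  by rewrite lt_neqAle eq_sym nz addr_ge0.
by rewrite mulr_gt0 ?pos.
Qed.

End PlaneGeometry.

(** * Semicircles as graphs of continuous functions *)

Lemma continuous_sign_change (R : realType) (h : R -> R) (x y : R) :
  continuous h -> h x < 0 -> 0 < h y ->
  exists2 c, h c = 0 & x < c < y \/ y < c < x.
Proof.
move=> ch hx hy.
have ends c : h c = 0 -> c != x /\ c != y.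
  by move=> hc; split; apply/eqP => E; move: hx hy; rewrite -E hc ltxx.
have mid : Num.min (h x) (h y) <= 0 <= Num.max (h x) (h y).
  by rewrite ge_min le_max (ltW hx) (ltW hy) orbT.
have [xy|yx] := leP x y.
  have [|c cI hc] := IVT xy _ mid; first exact: continuous_subspaceT.
  have [cx cy] := ends c hc; exists c => //; left.
  by move: cI; rewrite in_itv /= !lt_neqAle eq_sym cx cy.
have [||c cI hc] := @IVT R h y x 0 (ltW yx).
- exact: continuous_subspaceT.
- by rewrite minC maxC.
have [cx cy] := ends c hc; exists c => //; right.
by move: cI; rewrite in_itv /= !lt_neqAle (eq_sym y) cx cy.
Qed.

Lemma eq_sqr_sign (R : realDomainType) (a b : R) :
  a ^+ 2 = b ^+ 2 -> (0 <= a) = (0 <= b) -> a = b.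
Proof.
move=> /eqP; rewrite eqf_sqr => /orP [/eqP //|/eqP ->]; rewrite oppr_ge0.
by case: (ltgtP 0 b) => // <-; rewrite oppr0.
Qed.

Lemma opposite_sum_lt0 (R : realDomainType) (a b c : R) :
  a * b < 0 -> 0 < a * c -> (a + c) * b < 0.
Proof.
move=> ab ac; have a0 : a != 0 by apply/eqP => a0; rewrite a0 mul0r ltxx in ab.
have cb : c * b < 0.
  rewrite -(@pmulr_rlt0 _ (a ^+ 2)); last by rewrite exprn_even_gt0.
  by rewrite expr2 mulrACA nmulr_llt0.
by rewrite mulrDl -(addr0 0) ltrD.
Qed.

Definition semicircle (R : realType) (p q : R * R) (x : R) : R :=
  p.2 + (if p.2 <= q.2 then 1 else -1) * Num.sqrt (sqdist p q - (x - p.1) ^+ 2).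

Lemma semicircle_at (R : realType) (p q w : R * R) :
  sqdist p q = sqdist p w -> same_half p q w -> semicircle p q w.1 = w.2.
Proof.
rewrite /same_half /semicircle => -> /eqP ->.
have -> : sqdist p w - (w.1 - p.1) ^+ 2 = (w.2 - p.2) ^+ 2 by rewrite /sqdist; ring.
rewrite sqrtr_sqr; case: leP => h.
  by rewrite mul1r ger0_norm ?subr_ge0 // addrC subrK.
by rewrite mulN1r ltr0_norm ?subr_lt0 // opprK addrC subrK.
Qed.

(** The strict inequality keeps [w] off the height of the centre, where the lower graph would give a
    point counted as upper. *)
Lemma on_semicircle (R : realType) (p q w : R * R) :
  (w.1 - p.1) ^+ 2 < sqdist p q -> semicircle p q w.1 = w.2 ->
  sqdist p q = sqdist p w /\ same_half p q w.
Proof.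
rewrite -subr_gt0 => d0; rewrite /semicircle => h.
have s0 : 0 < Num.sqrt (sqdist p q - (w.1 - p.1) ^+ 2) by rewrite sqrtr_gt0.
have := sqr_sqrtr (ltW d0); move: s0 h; set s := Num.sqrt _ => s0 h s2.
split.
  have : (w.2 - p.2) ^+ 2 = s ^+ 2.
    by rewrite -h addrC addKr; case: ifP => _; rewrite ?mul1r ?mulN1r ?sqrrN.
  by rewrite s2 [sqdist p w]/sqdist -(sqrrN (p.1 - _)) -(sqrrN (p.2 - _)) !opprB => ->; ring.
rewrite /same_half -h; case: ifP => _; first by rewrite mul1r lerDl ltW.
by rewrite mulN1r lerDl oppr_ge0 leNgt s0.
Qed.

Lemma continuous_semicircle (R : realType) (p q : R * R) :
  continuous (semicircle p q).
Proof.
move=> x; apply: cvgD; first exact: cvg_cst.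
apply: cvgM; first exact: cvg_cst.
apply: (@continuous_comp _ _ _ (fun x => sqdist p q - (x - p.1) ^+ 2) Num.sqrt);
  last exact: sqrt_continuous.
apply: cvgB; first exact: cvg_cst.
by apply: cvgM; (apply: cvgB; [exact: cvg_id | exact: cvg_cst]).
Qed.

(** * The arcs joining consecutive points of a semicircle *)

Section DistinctDistances.
Variables (R : realType) (TP TQ TD : finType) (P : TP -> R * R) (Q : TQ -> R * R).
Variable (delta : TP -> TQ -> TD).
Hypotheses (P_inj : injective P) (Q_inj : injective Q).
Hypothesis deltaE : forall p q q',
  (delta p q == delta p q') = (sqdist (P p) (Q q) == sqdist (P p) (Q q')).

Local Notation qx q := (Q q).1.
Local Notation m := #|TP|.
Local Notation n := #|TQ|.
Local Notation D := #|TD|.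

(** A point of [Q] is determined by its distances to two fixed centres and its side of their
    line. *)
Lemma card_le_sqr : (1 < m)%N -> (n <= 2 * D ^ 2)%N.
Proof.
case/card_gt1P => p [p' [_ _ pp']].
pose F q := (delta p q, delta p' q, 0 <= side (P p) (P p') (Q q)).
have F_inj : injective F.
  move=> q q' [/eqP + /eqP + h]; rewrite !deltaE => /eqP h1 /eqP h2.
  apply: Q_inj; apply: (two_circles_inj _ h1 h2).
    by move=> /P_inj; apply/eqP.
  exact: eq_sqr_sign (two_circles_side h1 h2) h.
have := leq_card F F_inj; rewrite !card_prod card_bool.
by rewrite mulnC -mulnn.
Qed.

Definition mate p q q' :=
  (delta p q == delta p q') && same_half (P p) (Q q) (Q q').

Definition after p q q' := mate p q q' && (qx q < qx q').

(* [next p q] is [q] itself when [q] is the last point of its semicircle. *)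
Definition next p q :=
  odflt q [pick q' | after p q q' && [forall q'', after p q q'' ==> (qx q' <= qx q'')]].

Definition good (e : TP * TQ) :=
  (qx e.2 < qx (next e.1 e.2)) &&
  [forall p', 0 <= side (P e.1) (P p') (Q e.2) * side (P e.1) (P p') (Q (next e.1 e.2))].

Definition arc (e : TP * TQ) := semicircle (P e.1) (Q e.2).

Definition inside (e : TP * TQ) (x : R) := qx e.2 < x < qx (next e.1 e.2).

Definition crossing (e f : TP * TQ) :=
  (e != f) && `[< exists x, [/\ inside e x, inside f x & arc e x = arc f x] >].

Lemma mateP p q q' : reflect
  (sqdist (P p) (Q q) = sqdist (P p) (Q q') /\ same_half (P p) (Q q) (Q q'))
  (mate p q q').
Proof. by rewrite /mate deltaE; apply: (iffP andP) => -[/eqP h1 h2]; split=> //; apply/eqP. Qed.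

Lemma mate_inj p q q' : mate p q q' -> qx q = qx q' -> q = q'.
Proof.
move=> /mateP [h1 h2] hx; apply: Q_inj.
have := semicircle_at h1 h2; rewrite -hx semicircle_at /same_half ?eqxx // => hy.
by rewrite (surjective_pairing (Q q)) hx hy -surjective_pairing.
Qed.

Lemma next_after p q : qx q < qx (next p q) -> after p q (next p q).
Proof.
by rewrite /next; case: pickP => [z /andP [] //|_] /=; rewrite ltxx.
Qed.

Lemma next_le p q q' : after p q q' -> qx (next p q) <= qx q'.
Proof.
move=> aq'; rewrite /next; case: pickP => [z /andP [_ /forallP /(_ q')]|no] /=.
  by rewrite aq'.
by case/andP: aq' => _ /ltW.
Qed.

Lemma next_gt p q q' : after p q q' -> qx q < qx (next p q).
Proof.
move=> aq'; rewrite /next; case: pickP => [z /andP [/andP []] //|no] /=.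
have := no [arg min_(z < q' | after p q z) qx z]%O.
case: arg_minP => // z az zmin; rewrite az /= => /negP [].
by apply/forallP => z'; apply/implyP => /zmin.
Qed.

Lemma arc_start e : arc e (qx e.2) = (Q e.2).2.
Proof. by apply: semicircle_at; rewrite /same_half. Qed.

Lemma arc_end e : good e -> arc e (qx (next e.1 e.2)) = (Q (next e.1 e.2)).2.
Proof.
by move=> /andP [/next_after /andP [/mateP [h1 h2] _] _]; exact: semicircle_at.
Qed.

Lemma inside_on_arc e x : inside e x ->
  sqdist (P e.1) (Q e.2) = sqdist (P e.1) (x, arc e x)
  /\ same_half (P e.1) (Q e.2) (x, arc e x).
Proof.
move=> /andP [qx_x x_nx]; apply: on_semicircle => //=.
have /andP [/mateP [h _] _] := next_after (lt_trans qx_x x_nx).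
apply: (@sqr_lt_between _ (qx e.2 - (P e.1).1) _ (qx (next e.1 e.2) - (P e.1).1)).
- by rewrite ltrD2r.
- by rewrite ltrD2r.
- by rewrite /sqdist -(sqrrN ((P e.1).1 - _)) opprB lerDl sqr_ge0.
- by rewrite h /sqdist -(sqrrN ((P e.1).1 - _)) opprB lerDl sqr_ge0.
Qed.

(** A common point puts both arcs on one semicircle, and there the arc starting further left ends no
    later than the other starts. *)
Lemma arcs_of_circle_disjoint p q q' x :
  inside (p, q) x -> inside (p, q') x -> arc (p, q) x = arc (p, q') x ->
  q = q'.
Proof.
move=> xq xq' h.
have [h1 h2] := inside_on_arc xq; have [h3 h4] := inside_on_arc xq'.
rewrite /= -h in h3 h4; rewrite /= in h1 h2.
have qq' : mate p q q'.
  apply/mateP; split; first by rewrite h1 h3.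
  by rewrite /same_half (eqP h2) -(eqP h4).
have q'q : mate p q' q.
  apply/mateP; split; first by rewrite h1 h3.
  by rewrite /same_half (eqP h4) -(eqP h2).
apply: (mate_inj qq'); case/andP: xq => /= ? x_n; case/andP: xq' => /= ? x_n'.
have [lt|lt|//] := ltgtP (qx q) (qx q').
- have /next_le : after p q q' by apply/andP.
  by move=> le; have := lt_le_trans x_n le; rewrite ltNge ltW.
- have /next_le : after p q' q by apply/andP.
  by move=> le; have := lt_le_trans x_n' le; rewrite ltNge ltW.
Qed.

(* A second common point [(x, arc e x)] of the circles around [P e.1] and
   [P p'] through [Q u] is the mirror image of [Q u] in the line through the
   two centres, and no such line separates two points of a good arc. *)
Lemma good_arc_no_return e p' u x : good e -> e.1 != p' -> inside e x ->
  u = e.2 \/ u = next e.1 e.2 ->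
  sqdist (P p') (Q u) = sqdist (P p') (x, arc e x) -> False.
Proof.
move=> /andP [lt /forallP /(_ p') sep] ep' ex ue hp'.
have [h1 h2] := inside_on_arc ex.
have /andP [/mateP [h3 h4] _] := next_after lt.
set w := (x, arc e x) in h1 h2 hp'.
have [lt1 lt2] : qx e.2 < w.1 /\ w.1 < qx (next e.1 e.2) by apply/andP.
have h1' : sqdist (P e.1) (Q (next e.1 e.2)) = sqdist (P e.1) w by rewrite -h3.
have h2' : same_half (P e.1) (Q (next e.1 e.2)) w.
  by rewrite /same_half -(eqP h4).
have hu : sqdist (P e.1) (Q u) = sqdist (P e.1) w by case: ue => ->.
have PP : P e.1 <> P p' by move=> /P_inj /eqP; rewrite (negPf ep').
have uw : Q u <> w.
  by case: ue => -> E; move: lt1 lt2; rewrite -E ?ltxx.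
have /eqP := two_circles_side hu hp'; rewrite eqf_sqr => /orP [/eqP|/eqP] sE.
  by apply: uw; exact: two_circles_inj sE.
have su0 : side (P e.1) (P p') (Q u) != 0.
  apply/eqP => s0; apply: uw; apply: two_circles_inj hu hp' _ => //.
  by rewrite -[RHS]opprK -sE s0 oppr0.
have between := side_between lt1 lt2 h1 h1' h2 h2' sep.
move: between sep sE su0; set a := side _ _ (Q e.2); set b := side _ _ (Q (next _ _)).
set c := side _ _ w => between sep sE su0.
have su2 : 0 < side (P e.1) (P p') (Q u) ^+ 2 by rewrite lt_neqAle sqr_ge0 eq_sym sqrf_eq0 su0.
(* The side of [u] is [a] or [b], and [c] is its negative. So [(a + b) * c] is minus a positive
   number, against [between]. *)
have abu : side (P e.1) (P p') (Q u) * (a + b) = side (P e.1) (P p') (Q u) ^+ 2 + a * b.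
  by case: ue => ->; rewrite -/a -/b; ring.
have ab0 : a + b != 0.
  by apply/eqP => ab0; move: abu; rewrite ab0 mulr0; lra.
have := between ab0; rewrite -[c]opprK -sE mulrN oppr_gt0 mulrC abu; lra.
Qed.

Lemma endpoint_on_circle f u : good f -> u = f.2 \/ u = next f.1 f.2 ->
  sqdist (P f.1) (Q u) = sqdist (P f.1) (Q f.2).
Proof.
move=> /andP [/next_after /andP [/mateP [h _] _] _] [->|->] //.
Qed.

Lemma crossing_endpoints e f : good e -> good f -> crossing e f ->
  uniq [:: e.2; next e.1 e.2; f.2; next f.1 f.2].
Proof.
move=> ge gf /andP [/eqP ef /asboolP [x [xe xf Ex]]].
have pp : e.1 != f.1.
  apply/eqP => pp; apply: ef; move: e f pp {ge gf} xe xf Ex => [p q] [p' q'] /= <-.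
  by move=> xe xf /(arcs_of_circle_disjoint xe xf) ->.
have no_shared u v : u = e.2 \/ u = next e.1 e.2 ->
    v = f.2 \/ v = next f.1 f.2 -> u != v.
  move=> ue uf; apply/eqP => uv; rewrite -{v}uv in uf.
  apply: (good_arc_no_return ge pp xe ue).
  by rewrite (endpoint_on_circle gf uf) Ex; have [] := inside_on_arc xf.
have ne g : good g -> g.2 != next g.1 g.2.
  by case/andP => lt _; apply/eqP => h; move: lt; rewrite -h ltxx.
rewrite /= !inE !negb_or !ne // !andbT /=.
by do ![apply/andP; split]; apply: no_shared; [left|left|left|right|right|left|right|right].
Qed.

(** With two different centres, the endpoints would be mirror images in the line of centres. Not
    being separated by it, they would lie on it and coincide. *)
Lemma good_arc_determined e f : good e -> good f -> e.2 = f.2 ->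
  next e.1 e.2 = next f.1 f.2 -> e = f.
Proof.
move=> ge gf h1 h2; case: (eqVneq e.1 f.1) => [pp|pp].
  by rewrite (surjective_pairing e) pp h1 -surjective_pairing.
have hf := endpoint_on_circle gf (or_intror erefl).
have he := endpoint_on_circle ge (or_intror erefl).
rewrite -h2 -h1 in hf; have /andP [lt /forallP /(_ f.1) sep] := ge.
have PP : P e.1 <> P f.1 by move=> /P_inj /eqP; rewrite (negPf pp).
exfalso; have /eqP := two_circles_side he hf; rewrite eqf_sqr => /orP [/eqP|/eqP] sE.
  by move: lt; rewrite (two_circles_inj PP he hf sE) ltxx.
have s0 : side (P e.1) (P f.1) (Q e.2) = 0.
  apply/eqP; rewrite -sqrf_eq0 eq_le sqr_ge0 andbT -oppr_ge0.
  by move: sep; rewrite sE mulrN.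
have := two_circles_inj PP he hf; rewrite sE s0 oppr0 => /(_ erefl) h.
by move: lt; rewrite h ltxx.
Qed.

Lemma good_arcs_ordered e f x y :
  good e -> good f -> e = f \/ ~~ crossing e f ->
  qx e.2 <= x <= qx (next e.1 e.2) -> qx f.2 <= x <= qx (next f.1 f.2) ->
  qx e.2 <= y <= qx (next e.1 e.2) -> qx f.2 <= y <= qx (next f.1 f.2) ->
  arc e x < arc f x -> arc e y <= arc f y.
Proof.
move=> ge gf ef /andP [ex xe] /andP [fx xf] /andP [ey ye] /andP [fy yf] ltx.
rewrite leNgt; apply/negP => lty.
have ne : e <> f by move=> h; rewrite h ltxx in ltx.
case: ef => // /negP; apply; rewrite /crossing; apply/andP; split; first exact/eqP.
have ch : continuous (fun t => arc e t - arc f t).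
  by move=> t; apply: cvgB; exact: continuous_semicircle.
have [||c /eqP + cxy] := @continuous_sign_change R _ x y ch.
- by rewrite subr_lt0.
- by rewrite subr_gt0.
rewrite subr_eq0 => /eqP hc; apply/asboolP; exists c.
rewrite /inside; case: cxy => /andP [h1 h2].
  by rewrite (le_lt_trans ex) // (le_lt_trans fx) // (lt_le_trans h2 ye) (lt_le_trans h2 yf).
by rewrite (le_lt_trans ey) // (le_lt_trans fy) // (lt_le_trans h2 xe) (lt_le_trans h2 xf).
Qed.

Let G := [set e | good e].

Lemma good_arcs_linear_bound (S : {set TQ}) (F : {set TP * TQ}) :
  F \subset G -> {in F, forall e, (e.2 \in S) && (next e.1 e.2 \in S)} ->
  {in F &, forall e f, ~~ crossing e f} -> (#|F| <= 3 * #|S|)%N.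
Proof.
move=> /subsetP FG FS Fcr.
have gd e : e \in F -> good e by move/FG; rewrite inE.
apply: (@noncrossing_arcs_bound R _ _ (fun q => qx q) (fun q => (Q q).2)
  (fun e => e.2) (fun e => next e.1 e.2) arc) => //.
- move=> z z' h1 h2; apply: Q_inj.
  by rewrite (surjective_pairing (Q z)) h1 h2 -surjective_pairing.
- by move=> e /gd /andP [].
- by move=> e _; exact: arc_start.
- by move=> e /gd; exact: arc_end.
(* A point of [Q] inside the arc would come after [e.2] on its semicircle and before the next
   point. *)
- move=> e z eF zS zin hz.
  have [h1 h2] := inside_on_arc zin; rewrite hz -surjective_pairing in h1 h2.
  have /next_le : after e.1 e.2 z.
    by apply/andP; split; [exact/mateP | case/andP: zin].
  by rewrite leNgt; case/andP: zin => _ ->.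
- move=> e f x y eF fF; apply: good_arcs_ordered; try exact: gd.
  by right; exact: Fcr.
- move=> e f x eF fF ef xe xf h; move/negP: (Fcr e f eF fF); apply.
  by apply/andP; split; [exact/eqP | apply/asboolP; exists x].
- by move=> e f /gd ge /gd gf; exact: good_arc_determined.
Qed.

(** * Counting the crossings and the discarded arcs *)

Let X := [set ef : (TP * TQ) * (TP * TQ) |
  [&& ef.1 \in G, ef.2 \in G & crossing ef.1 ef.2]].

(** The two circles and the side of the line of centres determine the crossing point, and this point
    determines the arc on each circle. The bit [up] records the side, whence the factor 2. *)
Lemma card_crossings : (#|X| <= 2 * (m * D) ^ 2)%N.
Proof.
pose circ (e : TP * TQ) := (e.1, delta e.1 e.2).
pose up (ef : (TP * TQ) * (TP * TQ)) := `[< exists x,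
  [/\ inside ef.1 x, inside ef.2 x, arc ef.1 x = arc ef.2 x &
      0 <= side (P ef.1.1) (P ef.2.1) (x, arc ef.1 x)] >].
pose F ef := (circ ef.1, circ ef.2, up ef).
have same_circ e e' x : circ e = circ e' -> inside e x -> inside e' x ->
    arc e x = arc e' x -> e = e'.
  case: e e' => [p q] [p' q'] [/= <- _] xe xe' h.
  by rewrite (arcs_of_circle_disjoint xe xe' h).
have on_circ e e' x x' : circ e = circ e' -> inside e x -> inside e' x' ->
    sqdist (P e.1) (x, arc e x) = sqdist (P e.1) (x', arc e' x').
  case: e e' => [p q] [p' q'] [/= <- /eqP].
  by rewrite deltaE => /eqP h /inside_on_arc [<- _] /inside_on_arc [<- _].
have F_inj : {in X &, injective F}.
  move=> [e f] [e' f']; rewrite !inE /= => /and3P [_ _ cr] /and3P [_ _ cr'].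
  move=> [/= pe de pf df hup].
  have ce : circ e = circ e' by rewrite /circ de pe.
  have cf : circ f = circ f' by rewrite /circ df pf.
  have pp : P e.1 <> P f.1.
    move=> /P_inj pp; case/andP: cr => /eqP ef /asboolP [x [xe xf h]]; apply: ef.
    move: e f pp {pe de pf df hup ce cf} xe xf h => [p q] [p' q'] /= <- xe xf h.
    by rewrite (arcs_of_circle_disjoint xe xf h).
  have same_point x x' : inside e x -> inside f x -> arc e x = arc f x ->
      inside e' x' -> inside f' x' -> arc e' x' = arc f' x' ->
      (0 <= side (P e.1) (P f.1) (x, arc e x))
        = (0 <= side (P e.1) (P f.1) (x', arc e' x')) ->
      (e, f) = (e', f').
    move=> xe xf h xe' xf' h' s.
    have he := on_circ _ _ _ _ ce xe xe'.
    have hf := on_circ _ _ _ _ cf xf xf'; rewrite -h -h' in hf.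
    have [Ex Ey] := two_circles_inj pp he hf (eq_sqr_sign (two_circles_side he hf) s).
    rewrite -Ex in xe' xf' h' Ey.
    rewrite (same_circ e e' x) // (same_circ f f' x) //.
    by rewrite -h -h'.
  have [upT|upF] := boolP (up (e, f)).
    have upT' : up (e', f') by rewrite -hup.
    case/asboolP: upT => x [/= xe xf h s]; case/asboolP: upT' => x' [/= xe' xf' h' s'].
    by apply: (same_point x x') => //; rewrite s pe pf s'.
  have upF' : ~~ up (e', f') by rewrite -hup.
  case/andP: cr => _ /asboolP [x [xe xf h]]; case/andP: cr' => _ /asboolP [x' [xe' xf' h']].
  apply: (same_point x x') => //.
  have -> : (0 <= side (P e.1) (P f.1) (x, arc e x)) = false.
    by apply: contraNF upF => s; apply/asboolP; exists x.
  by apply/esym; apply: contraNF upF' => s; apply/asboolP; exists x'; rewrite /= -pe -pf.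
rewrite -(card_in_imset F_inj); apply: leq_trans (max_card _) _.
by rewrite !card_prod card_bool mulnC mulnn.
Qed.

Lemma card_last : (#|[set e : TP * TQ | ~~ (qx e.2 < qx (next e.1 e.2))%R]| <= 2 * (m * D))%N.
Proof.
pose F (e : TP * TQ) := (e.1, delta e.1 e.2, (P e.1).2 <= (Q e.2).2).
rewrite -(@card_in_imset _ _ F).
  by apply: leq_trans (max_card _) _; rewrite !card_prod card_bool mulnC.
move=> [p q] [p' q']; rewrite !inE /= => lq lq' [pp /eqP d s].
rewrite -{}pp in lq' d s *.
have qq' : mate p q q' by rewrite /mate d /same_half s eqxx.
have q'q : mate p q' q by rewrite /mate eq_sym d /same_half s eqxx.
congr (_, _); apply: (mate_inj qq').
have [lt|lt|//] := ltgtP (qx q) (qx q').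
- by case/negP: lq; apply: (@next_gt _ _ q'); apply/andP.
- by case/negP: lq'; apply: (@next_gt _ _ q); apply/andP.
Qed.

(** A line through the centre cuts a semicircle only once. Two separated arcs would give two sign
    changes of [side], so that either [next p q] between [q] and [q'], or [q'] between [q] and
    [next p q'], contradicts [side_between]. *)
Lemma no_two_separations p p' q q' : mate p q q' -> qx q < qx q' ->
  qx q < qx (next p q) -> qx q' < qx (next p q') ->
  side (P p) (P p') (Q q) * side (P p) (P p') (Q (next p q)) < 0 ->
  side (P p) (P p') (Q q') * side (P p) (P p') (Q (next p q')) < 0 -> False.
Proof.
move=> qq' lt lq lq' sep sep'.
have /andP [/mateP [h1 h2] _] := next_after lq.
have /andP [/mateP [h1' h2'] _] := next_after lq'.
have /mateP [h3 h4] := qq'.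
have le : qx (next p q) <= qx q' by apply: next_le; apply/andP.
have nz (a b : R) : a * b < 0 -> a != 0.
  by move=> ab; apply/eqP => a0; rewrite a0 mul0r ltxx in ab.
have [pos|neg] := ltP 0 (side (P p) (P p') (Q q) * side (P p) (P p') (Q q')).
  have := opposite_sum_lt0 sep pos; rewrite ltNge => /negP; apply; apply/ltW.
  apply: side_between => //.
  - rewrite lt_neqAle le andbT; apply/eqP => eqx.
    have E : next p q = q'.
      apply: (@mate_inj p) eqx; apply/mateP; split; first by rewrite -h1 -h3.
      by rewrite /same_half -(eqP h2) -(eqP h4).
    by move: sep; rewrite E ltNge (ltW pos).
  - by rewrite -h3 -h1.
  - by rewrite /same_half -(eqP h2) -(eqP h4).
  - exact: ltW.
  - exact: nz (opposite_sum_lt0 sep pos).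
have neg' : side (P p) (P p') (Q q) * side (P p) (P p') (Q q') < 0.
  by rewrite lt_neqAle neg mulf_neq0 // (nz _ _ sep, nz _ _ sep').
have pos : 0 < side (P p) (P p') (Q q) * side (P p) (P p') (Q (next p q')).
  rewrite -(@pmulr_rgt0 _ (side (P p) (P p') (Q q') ^+ 2)).
    by rewrite expr2 mulrACA nmulr_rgt0 // mulrC.
  by rewrite exprn_even_gt0 //= (nz _ _ sep').
have := opposite_sum_lt0 neg' pos; rewrite ltNge => /negP; apply; apply/ltW.
apply: side_between => //.
- by rewrite /same_half -(eqP h2').
- exact: ltW.
- exact: nz (opposite_sum_lt0 neg' pos).
Qed.

(** An arc is charged to its semicircle and to a centre [w e] whose line separates its endpoints. *)
Lemma card_separated :
  (#|[set e : TP * TQ | (qx e.2 < qx (next e.1 e.2))%R && ~~ good e]|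
    <= 2 * (m * D) * m)%N.
Proof.
pose sep (e : TP * TQ) p' :=
  side (P e.1) (P p') (Q e.2) * side (P e.1) (P p') (Q (next e.1 e.2)) < 0.
pose w e := odflt e.1 [pick p' | sep e p'].
have wP e : qx e.2 < qx (next e.1 e.2) -> ~~ good e -> sep e (w e).
  rewrite /good => -> /=; rewrite negb_forall => /existsP [p' hp'].
  rewrite /w; case: pickP => [//|/(_ p')].
  by rewrite /sep ltNge hp'.
pose F (e : TP * TQ) := (e.1, delta e.1 e.2, (P e.1).2 <= (Q e.2).2, w e).
rewrite -(@card_in_imset _ _ F).
  apply: leq_trans (max_card _) _; rewrite !card_prod card_bool.
  by rewrite (mulnC _ 2).
move=> [p q] [p' q']; rewrite !inE /= => /andP [lq gq] /andP [lq' gq'].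
have := wP (p, q) lq gq; have := wP (p', q') lq' gq'; rewrite /F.
move: (w _) (w _) => w1 w2 /= sq' sq [pp /eqP d s ww].
rewrite -{}pp -{}ww in lq' d s sq' *.
have qq' : mate p q q' by rewrite /mate d /same_half s eqxx.
have q'q : mate p q' q by rewrite /mate eq_sym d /same_half s eqxx.
congr (_, _); apply: (mate_inj qq').
have [lt|lt|//] := ltgtP (qx q) (qx q').
- by case: (no_two_separations qq' lt lq lq' sq sq').
- by case: (no_two_separations q'q lt lq' lq sq' sq).
Qed.

Lemma card_good : (m * n <= #|G| + 2 * (m * D) + 2 * (m * D) * m)%N.
Proof.
rewrite -card_prod -(cardsC G) -addnA leq_add2l.
apply: leq_trans (leq_add card_last card_separated).
apply: leq_trans (leq_card_setU _ _); apply: subset_leq_card.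
by apply/subsetP => e; rewrite !inE; case: (_ < _).
Qed.

Lemma bipartite_distances_bound : (1 < m)%N -> (m ^ 3 <= n)%N ->
  (m * n <= 4608 * D ^ 2)%N.
Proof.
move=> m1 mn.
have [m12|m12] := ltnP m 12.
  have := card_le_sqr m1; nia.
(* If [n < 8 m D], squaring and [m ^ 3 <= n] already give [m n <= 64 D ^ 2]. Otherwise each of the
   two discarded families has at most [m n / 4] arcs. *)
have [nD|nD] := ltnP n (8 * (m * D)).
  have h : (n * n <= (8 * (m * D)) * (8 * (m * D)))%N by apply: leq_mul; exact: ltnW.
  have : (m * n * m ^ 2 <= 64 * D ^ 2 * m ^ 2)%N by nia.
  rewrite leq_pmul2r ?expn_gt0 ?(ltnW m1) //; nia.
(* With [12 k <= m], twice the vertex term [3 n k ^ 3] is at most half of [m n k ^ 2], leaving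
   [n k ^ 2 <= 8 m D ^ 2]. Then [m <= 24 k] gives the constant [4608 = 8 * 24 ^ 2]. *)
pose k := (m %/ 12)%N.
have k0 : (0 < k)%N by rewrite divn_gt0.
have km : (12 * k <= m)%N by rewrite mulnC leq_trunc_div.
have mk : (m <= 24 * k)%N by rewrite /k in k0 *; lia.
have cl : (#|G| * k ^ 2 <= 3 * n * k ^ 3 + #|X|)%N.
  apply: (@crossing_lemma _ _ (fun e => e.2) (fun e => next e.1 e.2)) k0.
  - move=> e; rewrite inE => /andP [lt _].
    by apply/eqP => h; move: lt; rewrite -h ltxx.
  - by move=> e f; rewrite !inE; exact: crossing_endpoints.
  - exact: good_arcs_linear_bound.
have gb : (m * n <= 2 * #|G|)%N by have := card_good; nia.
have := leq_trans cl (leq_add (leqnn _) card_crossings).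
move: (#|G|) gb => g gb ub.
have h1 : (m * n * k ^ 2 <= 2 * (g * k ^ 2))%N by rewrite mulnA leq_mul2r gb orbT.
have h2 : (12 * k * (n * k ^ 2) <= m * (n * k ^ 2))%N by rewrite leq_mul2r km orbT.
have h3 : (m * (n * k ^ 2) <= m * (8 * (m * D ^ 2)))%N by nia.
rewrite leq_pmul2l ?(ltnW m1) // in h3.
have h4 : (m * m * n <= (24 * k) * (24 * k) * n)%N by rewrite leq_mul2r leq_mul ?orbT.
have : (m * (m * n) <= m * (4608 * D ^ 2))%N by nia.
by rewrite leq_pmul2l ?(ltnW m1).
Qed.
End DistinctDistances.

(** * From finite types to finite sets of points, and the real exponent *)

Lemma eq_dist_sqdist (R : realType) (p q q' : R * R) :
  (dist p q == dist p q') = (sqdist p q == sqdist p q').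
Proof. by rewrite /dist eqr_sqrt ?addr_ge0 ?sqr_ge0. Qed.

Lemma num_dist_bound (R : realType) (P Q : {fset R * R}) :
  (1 < #|` P|)%N -> (#|` P| ^ 3 <= #|` Q|)%N ->
  (#|` P| * #|` Q| <= 4608 * num_dist P Q ^ 2)%N.
Proof.
rewrite /num_dist; set T := [fset _ | _ in P, _ in Q]%fset => P1 PQ.
have inT (p : P) (q : Q) : dist (val p) (val q) \in T.
  by apply: in_imfset2; exact: valP.
rewrite !cardfE in P1 PQ *.
apply: (@bipartite_distances_bound R _ _ _ val val (fun p q => [` inT p q]%fset)) => //.
- exact: val_inj.
- exact: val_inj.
- by move=> p q q'; rewrite -eq_dist_sqdist -val_eqE.
Qed.

Theorem theorem1p4 (R : realType) :
  exists c : R, 0 < c /\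
    forall m n : nat,
      (2 <= m)%N -> m%:R <= (n%:R : R) `^ (3%:R^-1) ->
      c * Num.sqrt (m * n)%:R <= (min_dist R m n)%:R.
Proof.
(* [68 ^ 2 = 4624] exceeds 4608. *)
exists 68%:R^-1; split; first by rewrite invr_gt0 ltr0n.
move=> m n m2 mn; rewrite /min_dist; case: ex_minnP => D /asboolP + _.
move=> [P [Q [Pm Qn <-]]].
have m3n : (m ^ 3 <= n)%N.
  rewrite -(ler_nat R) natrX.
  apply: le_trans (_ : ((n%:R : R) `^ (3%:R^-1)) ^+ 3 <= _).
    by rewrite lerXn2r ?nnegrE ?ler0n ?powR_ge0.
  by rewrite -powR_mulrn ?powR_ge0 // -powRrM mulVf ?pnatr_eq0 // powRr1 ?ler0n.
have := @num_dist_bound R P Q; rewrite Pm Qn => /(_ m2 m3n) bound.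
rewrite ler_pdivrMl ?ltr0n // -[leRHS]ger0_norm ?mulr_ge0 ?ler0n // -sqrtr_sqr.
rewrite ler_wsqrtr // -natrM -natrX ler_nat; nia.
Qed.
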